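(* Let $\mathcal{I}\subset\mathbb{R}$ be an open interval and let $\Phi:\mathcal{I}\to\mathbb{R}$ be smooth and convex and such that $A^\Phi$ is convex on $\mathcal{T}_{\mathcal{I}}$. Let $n\in\mathbb{N}^*$, let $p_1,\ldots,p_n\in[0,1]$, $q_i:=1-p_i$, let $M:=\mathcal{B}(1,p_1)*\cdots*\mathcal{B}(1,p_n)$ and $C_M:=\max\{p_1q_1,\ldots,p_nq_n\}$. Let $h:\mathbb{N}\to\mathbb{R}$ be $h(k)=k$. Then for any $f:\mathbb{N}\to\mathcal{I}$, $$\mathbf{Ent}_{M}^{\Phi}(f)\leq C_M\,\mathbf{E}_{M}\big((n-h)A^\Phi(f,\mathrm{D}f)+hA^\Phi(f,\mathrm{D}^*f)\big).$$ In particular, for any $n\in\mathbb{N}^*$, any $p\in[0,1]$ with $q:=1-p$, and any $f:\mathbb{N}\to\mathcal{I}$, $$\mathbf{Ent}_{\mathcal{B}(n,p)}^{\Phi}(f)\leq pq\,\mathbf{E}_{\mathcal{B}(n,p)}\big((n-h)A^\Phi(f,\mathrm{D}f)+hA^\Phi(f,\mathrm{D}^*f)\big).$$ Moreover, $$\mathbf{Ent}_{\mathcal{B}(n,p)}^{\Phi}(f)\leq npq\,\mathbf{E}_{\mathcal{B}(n-1,p)}\big(qA^\Phi(f,\mathrm{D}f)+pA^\Phi(\tau(f,\mathrm{D}f))\big).$$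
   Context: $\mathbb{N}=\{0,1,2,\ldots\}$, $\mathbb{N}^*=\mathbb{N}\setminus\{0\}$. $\mathcal{B}(n,p)$ is the binomial law $(p\delta_1+(1-p)\delta_0)^{*n}$ on $\mathbb{N}$ (with $\mathcal{B}(0,p)=\delta_0$), and $*$ is convolution. $\mathbf{E}_Q(f)$ is the mean of $f$ under the probability measure $Q$. For $f$ with values in $\mathcal{I}$, the $\Phi$-entropy is $\mathbf{Ent}_Q^\Phi(f):=\mathbf{E}_Q(\Phi(f))-\Phi(\mathbf{E}_Q f)$. For an open interval $\mathcal{I}$, $\mathcal{T}_{\mathcal{I}}:=\{(u,v)\in\mathbb{R}^2: u\in\mathcal{I},\,u+v\in\mathcal{I}\}$, and $A^\Phi:\mathcal{T}_{\mathcal{I}}\to\mathbb{R}$ is $A^\Phi(u,v):=\Phi(u+v)-\Phi(u)-\Phi'(u)v$. The map $\tau:\mathcal{T}_{\mathcal{I}}\to\mathcal{T}_{\mathcal{I}}$ is $\tau(u,v):=(u+v,-v)$. Discrete gradients: $\mathrm{D}f(k):=f(k+1)-f(k)$ and $\mathrm{D}^*f(k):=f(k-1)-f(k)$. The function $A^\Phi(f,\mathrm{D}f)$ is $k\mapsto A^\Phi(f(k),\mathrm{D}f(k))$, and similarly for $A^\Phi(f,\mathrm{D}^*f)$ and $A^\Phi(\tau(f,\mathrm{D}f))$. The value of $f$ at $-1$ need not be defined, since the term $hA^\Phi(f,\mathrm{D}^*f)$ is understood to be $0$ at $k=0$. *)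

(* Defs.v *)
From HB Require Import structures.
From mathcomp Require Import all_boot all_order all_algebra.
From mathcomp Require Import all_classical all_reals all_analysis.
From mathcomp Require Import measurable_realfun.
Import Order.TTheory GRing.Theory Num.Theory.
Import numFieldNormedType.Exports.

Set Implicit Arguments.
Unset Strict Implicit.
Unset Printing Implicit Defensive.

Local Open Scope classical_set_scope.
Local Open Scope ring_scope.

Section bernoulli_nat.
Context {R : realType}.

(** The library's [bernoulli_prob] lives on [bool]; this is the law
    [p delta_1 + (1 - p) delta_0] on [nat]. *)
Definition bernoulli_nat (p : {i01 R}) : set nat -> \bar R :=
  measure_add (mscale (p%:num)%:nng \d_1%N) (mscale (1 - p%:num)%:nng \d_0%N).

HB.instance Definition _ (p : {i01 R}) := Measure.on (bernoulli_nat p).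

Let bernoulli_nat_setT (p : {i01 R}) : bernoulli_nat p [set: nat] = 1%E.
Proof.
by rewrite /bernoulli_nat measure_addE/= /mscale/= !diracT !mule1 -EFinD subrKC.
Qed.

HB.instance Definition _ (p : {i01 R}) :=
  Measure_isProbability.Build _ _ _ (bernoulli_nat p) (bernoulli_nat_setT p).

End bernoulli_nat.

Section convolution.
Context {R : realType}.

Definition addn_pair (z : nat * nat) : nat := (z.1 + z.2)%N.

Let measurable_addn_pair : measurable_fun [set: nat * nat] addn_pair.
Proof. exact: measurable_fun_addn. Qed.

Definition convolution (P Q : probability nat R) : set nat -> \bar R :=
  pushforward (P \x Q)%E addn_pair.

Variables P Q : probability nat R.

Let convolution0 : convolution P Q set0 = 0%E.
Proof. exact: measure0. Qed.

Let convolution_ge0 A : (0 <= convolution P Q A)%E.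
Proof. exact: measure_ge0. Qed.

Let convolution_sigma_additive : semi_sigma_additive (convolution P Q).
Proof. exact: measure_semi_sigma_additive. Qed.

HB.instance Definition _ := isMeasure.Build _ _ _ (convolution P Q)
  convolution0 convolution_ge0 convolution_sigma_additive.

Let convolution_setT : convolution P Q [set: nat] = 1%E.
Proof.
rewrite /convolution /pushforward preimage_setT -setXTT.
rewrite [LHS]product_measure1E// -[RHS]mule1.
by congr (_ * _)%E; exact: probability_setT.
Qed.

HB.instance Definition _ :=
  Measure_isProbability.Build _ _ _ (convolution P Q) convolution_setT.

End convolution.

Section laws.
Context {R : realType}.

(** [B(1, p 0) * ... * B(1, p n.-1)], as a right fold seeded with [delta_0],
    which is the unit of [*]. *)
Definition bernoulli_convolution (n : nat) (p : 'I_n -> {i01 R}) :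
    probability nat R :=
  \big[(fun P Q : probability nat R => convolution P Q : probability nat R)
       / (\d_0%N : probability nat R)]_(i < n) bernoulli_nat (p i).

Definition binomial_law (n : nat) (p : {i01 R}) : probability nat R :=
  bernoulli_convolution (fun _ : 'I_n => p).

(** [max(p_1 q_1, ..., p_n q_n)] for [n > 0]: the terms being nonnegative, the
    seed [0] has no effect. *)
Definition max_pq (n : nat) (p : 'I_n -> {i01 R}) : R :=
  \big[Num.max/0]_(i < n) ((p i)%:num * (1 - (p i)%:num)).

End laws.

Section entropy.
Context {R : realType}.

(** [Phi] is only meaningful on an open interval [I]; it is represented by a
    total function, whose values outside [I] are irrelevant. In particular the
    derivatives of [Phi] at a point of [I] only depend on [Phi] on [I]. *)
Definition smooth_on (I : set R) (Phi : R -> R) :=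
  forall (m : nat) (x : R), I x -> derivable (Phi^`(m))%classic x 1.

(** Only used for finitely supported laws, for which every [f : nat -> R] is
    integrable. *)
Definition mean (Q : probability nat R) (f : nat -> R) : R := \int[Q]_k f k.

Definition Ent (Phi : R -> R) (Q : probability nat R) (f : nat -> R) : R :=
  mean Q (Phi \o f) - Phi (mean Q f).

Definition domT (I : set R) : set (R^o * R^o)%type :=
  [set w | I w.1 /\ I (w.1 + w.2)].

Definition Aphi (Phi : R -> R) (w : R * R) : R :=
  Phi (w.1 + w.2) - Phi w.1 - (Phi^`())%classic w.1 * w.2.

Definition tau (w : R * R) : R * R := (w.1 + w.2, - w.2).

Definition Dgrad (f : nat -> R) (k : nat) : R := f k.+1 - f k.

(** The value at [0], here [0] since [0.-1 = 0], is irrelevant: it only occurs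
    with the factor [h 0 = 0]. *)
Definition Dgrad_star (f : nat -> R) (k : nat) : R := f k.-1 - f k.

End entropy.

(* Main.v *)
Require Import Defs.
From HB Require Import structures.
From mathcomp Require Import all_boot all_order all_algebra.
From mathcomp Require Import all_classical all_reals all_analysis.
From mathcomp Require Import measurable_realfun ring lra.
Import Order.TTheory GRing.Theory Num.Theory.
Import numFieldNormedType.Exports.

Local Open Scope classical_set_scope.
Local Open Scope ring_scope.

(** Conditioning on the first Bernoulli variable, of parameter [p], gives
    [Ent_{n+1}(f) = E_n(Ent_p of k |-> (f(k), f(k+1))) + Ent_n(g)] where
    [g(k) = p f(k+1) + q f(k)]. The second term is bounded by induction, and
    convexity of [A] distributes [A(g, Dg)] and [A(g, D*g)] over [f] and its
    shift. The first term is the case [n = 1], where the right-hand side is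
    the entropy one would obtain by replacing [Phi], between the two values of
    [f], by its cubic Hermite interpolant; it thus suffices that [Phi''] be
    convex, which follows from the convexity of [A] near [v = 0]. *)

(** * Integration against a convolution with a Bernoulli law *)

Lemma integral_bernoulli_nat (R : realType) (p : {i01 R}) (f : nat -> \bar R) :
  (forall k, (0 <= f k)%E) ->
  (\int[bernoulli_nat p]_k f k = p%:num%:E * f 1%N + (1 - p%:num)%:E * f 0%N)%E.
Proof.
move=> f0; rewrite /bernoulli_nat.
rewrite (ge0_integral_measure_add _ _ measurableT)//.
by rewrite !ge0_integral_mscale//= !integral_dirac// !diracT !mul1e.
Qed.

Lemma convolution_bernoulli (R : realType) (p : {i01 R})
    (Q : probability nat R) (A : set nat) :
  convolution (bernoulli_nat p) Q A =
  (p%:num%:E * Q (succn @^-1` A) + (1 - p%:num)%:E * Q A)%E.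
Proof.
rewrite /convolution /pushforward /product_measure1 integral_bernoulli_nat//=.
by congr (_ * Q _ + _ * Q _)%E; apply/seteqP; split => k; rewrite /xsection/= inE.
Qed.

(** As a measure, the convolution is the mixture of [Q] pushed forward by [succn], with weight [p],
    and of [Q] itself, with weight [1 - p]. *)
Lemma integral_convolution_bernoulli (R : realType) (p : {i01 R})
    (Q : probability nat R) (f : nat -> \bar R) :
  (forall k, (0 <= f k)%E) ->
  (\int[convolution (bernoulli_nat p) Q]_k f k =
   p%:num%:E * \int[Q]_k f k.+1 + (1 - p%:num)%:E * \int[Q]_k f k)%E.
Proof.
move=> f0.
have mS : measurable_fun [set: nat] succn by [].
rewrite (eq_measure_integral (measure_add
    (mscale (p%:num)%:nng (pushforward Q succn)) (mscale (1 - p%:num)%:nng Q))).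
  rewrite (ge0_integral_measure_add _ _ measurableT)// !ge0_integral_mscale//=.
  by rewrite ge0_integral_pushforward.
move=> A _ _; rewrite [RHS]measure_addE.
exact: convolution_bernoulli.
Qed.

Lemma integrable_convolution_bernoulli (R : realType) (p : {i01 R})
    (Q : probability nat R) :
  (forall f : nat -> R, Q.-integrable setT (EFin \o f)) ->
  forall f : nat -> R,
    (convolution (bernoulli_nat p) Q).-integrable setT (EFin \o f).
Proof.
move=> intQ f; apply/integrableP; split; first by [].
rewrite integral_convolution_bernoulli => [|k]; last exact: abse_ge0.
have /integrableP[_ i0] := intQ f.
have /integrableP[_ i1] := intQ (fun k => f k.+1).
by apply: lte_add_pinfty; apply: lte_mul_pinfty => //;
  rewrite lee_fin ?subr_ge0 ?ge0 ?le1.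
Qed.

Lemma bernoulli_convolution_recl (R : realType) (n : nat)
    (p : 'I_n.+1 -> {i01 R}) :
  bernoulli_convolution p =
  convolution (bernoulli_nat (p ord0))
    (bernoulli_convolution (p \o lift ord0)) :> probability nat R.
Proof. by rewrite /bernoulli_convolution big_ord_recl. Qed.

(** This stands in for finiteness of the support: every real function on [nat] is integrable, so
    means are linear without side conditions. *)
Lemma integrable_bernoulli_convolution (R : realType) (n : nat)
    (p : 'I_n -> {i01 R}) (f : nat -> R) :
  (bernoulli_convolution p).-integrable setT (EFin \o f).
Proof.
elim: n p f => [|n IHn] p f.
  rewrite /bernoulli_convolution big_ord0; apply/integrableP; split; first by [].
  by rewrite integral_dirac// diracT mul1e ltry.
by rewrite bernoulli_convolution_recl; exact: integrable_convolution_bernoulli.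
Qed.

Lemma mean_bernoulli_convolution0 (R : realType) (p : 'I_0 -> {i01 R})
    (f : nat -> R) : mean (bernoulli_convolution p) f = f 0%N.
Proof.
rewrite /mean /Rintegral /bernoulli_convolution big_ord0 integral_dirac//.
by rewrite diracT mul1e.
Qed.

Lemma mean_bernoulli_convolutionS (R : realType) (n : nat)
    (p : 'I_n.+1 -> {i01 R}) (f : nat -> R) :
  mean (bernoulli_convolution p) f =
  mean (bernoulli_convolution (p \o lift ord0))
    (fun k => (p ord0)%:num * f k.+1 + (1 - (p ord0)%:num) * f k).
Proof.
rewrite /mean bernoulli_convolution_recl.
set Q := bernoulli_convolution _.
have intQ g : Q.-integrable setT (EFin \o g).
  exact: integrable_bernoulli_convolution.
have intC g := integrable_convolution_bernoulli R (p ord0) Q intQ g.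
(* The extended-valued formula covers nonnegative functions only. It is made real here, then
   extended to [f] through positive and negative parts. *)
have fpos g : (forall k, 0 <= g k) ->
    \int[convolution (bernoulli_nat (p ord0)) Q]_k g k =
    (p ord0)%:num * \int[Q]_k g k.+1 + (1 - (p ord0)%:num) * \int[Q]_k g k.
  move=> g0; rewrite {1}/Rintegral integral_convolution_bernoulli => [|k];
    last by rewrite lee_fin.
  have i0 := integrable_fin_num measurableT (intQ g).
  have i1 := integrable_fin_num measurableT (intQ (g \o succn)).
  by rewrite fineD ?fin_numM// !fineM.
rewrite RintegralD// ?RintegralZl//;
  try exact: (intQ (fun _ => _)); try exact: (intQ (f \o succn)).
have -> : f = fun k => f^\+ k - f^\- k :> R.
  by rewrite -[LHS]funrposBneg.
rewrite !RintegralB// ?fpos//; try exact: intC; try exact: (intQ (_ \o succn)).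
by ring.
Qed.

(** * Derivatives along a line and tangents of convex functions *)

Lemma is_derive1_affine (R : realType) (a d t : R) :
  is_derive t 1 (fun s : R => a + s * d) d.
Proof.
have -> : (fun s : R => a + s * d) = cst a + d *: (id : R -> R).
  by apply/funext => s; rewrite !fctE mulrC.
have idd : is_derive t 1 (id : R -> R) 1 by exact: is_derive_id.
have dd : is_derive t 1 (d *: (id : R -> R)) (d *: 1) by exact: is_deriveZ.
have da : is_derive t 1 (cst a : R -> R) 0 by exact: is_derive_cst.
have h := is_deriveD da dd.
apply: (is_derive_eq h).
by rewrite add0r /GRing.scale/= mulr1.
Qed.

Lemma is_derive1_line (R : realType) (f : R -> R) (a d t df : R) :
  is_derive (a + t * d) 1 f df ->
  is_derive t 1 (fun s => f (a + s * d)) (df * d).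
Proof.
move=> fdf.
exact: (@is_derive1_comp R f (fun s => a + s * d) t _ _ fdf
  (is_derive1_affine R a d t)).
Qed.

Lemma is_derive1_cvg (R : realType) (f : R -> R) (x df : R) :
  is_derive x 1 f df -> (f (x + h) - f x) / h @[h --> 0^'] --> df.
Proof.
move=> [/cvg_ex[l fl] <-].
rewrite /derive (cvg_lim _ fl)//.
apply: cvg_trans fl; apply: near_eq_cvg; near=> h => /=.
by rewrite /GRing.scale/= mulr1 [h + x]addrC mulrC.
Unshelve. all: by end_near. Qed.

(** Mean value theorem on [[0, t]]. It serves twice in the two-point inequality, to pass from [G'']
    to [G'] and from [G'] to [G]. *)
Lemma is_derive1_ge0_le (R : realType) (f df : R -> R) :
  (forall t : R, t \in `[0, 1] -> is_derive t 1 f (df t)) ->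
  (forall t : R, t \in `[0, 1] -> 0 <= df t) ->
  forall t : R, t \in `[0, 1] -> f 0 <= f t.
Proof.
move=> fdf df0 t /[!in_itv]/= /andP[t0 t1].
have in01 s : s \in `[0, t] -> s \in `[0, 1].
  by rewrite !in_itv/= => /andP[-> st]; exact: le_trans st t1.
have fdf0t s : s \in `]0, t[ -> is_derive s 1 f (df s).
  by move=> s0t; exact/fdf/in01/subset_itv_oo_cc.
have cf : {within `[0, t], continuous f}.
  by apply: derivable_within_continuous => s s0t; exact/ex_derive/fdf/in01.
have [s s0t fE] := MVT_segment t0 fdf0t cf.
by rewrite -subr_ge0 fE subr0 mulr_ge0// df0// in01.
Qed.

Lemma convex_functionP (R : realType) (E : lmodType R) (D : set E)
    (f : E -> R) :
  convex_function (D : set (convex_lmodType E)) (f : convex_lmodType E -> R^o)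
  <-> forall t x y, 0 <= t <= 1 -> D x -> D y ->
      f (t *: x + (1 - t) *: y) <= t * f x + (1 - t) * f y.
Proof.
split=> [fconv t x y /andP[t0 t1] Dx Dy|fconv t x y /[!inE] Dx Dy].
  by have := fconv (Itv01 t0 t1) x y; rewrite !inE; exact.
by have := fconv t%:num x y; rewrite ge0 le1; exact.
Qed.

(** For [0 < h <= 1], convexity bounds the quotient [(f (x + h (y - x)) - f x) / h] by [f y - f x];
    then [h] tends to 0 from the right. *)
Lemma convex_tangent (R : realType) (I : set R) (f : R -> R) (x y df : R) :
  convex_function (I : set R^o) (f : R^o -> R^o) -> I x -> I y ->
  is_derive x 1 f df -> df * (y - x) <= f y - f x.
Proof.
move=> fconv Ix Iy fdf.
have /is_derive1_cvg/cvg_dnbhs_at_right :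
    is_derive (0 : R) 1 (fun s : R => f (x + s * (y - x))) (df * (y - x)).
  by apply: is_derive1_line; rewrite mul0r addr0.
move=> qdf; rewrite -(cvg_lim _ qdf)//; apply: limr_le.
  by apply/cvg_ex; eexists; exact: qdf.
near=> h.
have h0 : 0 < h by [].
have h1 : h <= 1 by near: h; exact: nbhs_right_le.
have h01 : 0 <= h <= 1 by rewrite (ltW h0).
have /convex_functionP/(_ h y x h01 Iy Ix) := fconv.
rewrite add0r mul0r addr0 ler_pdivrMr// => fh.
have -> : x + h * (y - x) = h *: y + (1 - h) *: x.
  by rewrite /GRing.scale/=; ring.
by rewrite lerBlDr (le_trans fh)// le_eqVlt; apply/predU1P; left; ring.
Unshelve. all: by end_near. Qed.

(** * Nonnegativity of [A] and convexity of [Phi''] *)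

Lemma is_derive_smooth_on (R : realType) (I : set R) (Phi : R -> R) (m : nat)
    (x : R) :
  smooth_on I Phi -> I x -> is_derive x 1 (Phi^`(m))%classic (Phi^`(m.+1)%classic x).
Proof.
by move=> Phi_smooth Ix; rewrite derive1nS derive1E; exact/derivableP/Phi_smooth.
Qed.

Lemma is_interval_conv (R : realType) (I : set R) (t x y : R) :
  is_interval I -> 0 <= t <= 1 -> I x -> I y -> I (t * x + (1 - t) * y).
Proof.
move=> I_itv /andP[t0 t1] Ix Iy.
case: (leP x y) => [xy|/ltW yx].
  by apply: (I_itv x y) => //; apply/andP; split; nra.
by apply: (I_itv y x) => //; apply/andP; split; nra.
Qed.

(** [A(u, v)] is the gap at [u + v] between [Phi] and its tangent at [u]. Its sign is what allows
    [p_i q_i] to be enlarged to a common constant. *)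
Lemma Aphi_ge0 (R : realType) (I : set R) (Phi : R -> R) (w : R * R) :
  smooth_on I Phi -> convex_function (I : set R^o) (Phi : R^o -> R^o) ->
  domT I w -> 0 <= Aphi Phi w.
Proof.
move=> Phi_smooth Phi_convex [Iu Iuv].
have := convex_tangent R I Phi w.1 (w.1 + w.2) _ Phi_convex Iu Iuv
  (is_derive_smooth_on R I Phi 0 w.1 Phi_smooth Iu).
by rewrite derive1n1 addrAC subrr add0r /Aphi subr_ge0.
Qed.

Lemma Aphi_conv (R : realType) (I : set R) (Phi : R -> R) (t u v u' v' : R) :
  convex_function (domT I) (Aphi Phi : (R^o * R^o)%type -> R^o) ->
  0 <= t <= 1 -> domT I (u, v) -> domT I (u', v') ->
  Aphi Phi (t * u + (1 - t) * u', t * v + (1 - t) * v') <=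
  t * Aphi Phi (u, v) + (1 - t) * Aphi Phi (u', v').
Proof.
move=> A_convex t01 Tw Tw'.
exact: ((convex_functionP R (R^o * R^o)%type (domT I) (Aphi Phi)).1 A_convex
  t (u, v) (u', v') t01 Tw Tw').
Qed.

(** Since [A(u,v) + A(tau(u,v)) = v (Phi'(u + v) - Phi'(u))], convexity of [A]
    makes the difference quotients of [Phi'] of a given step convex in [u]. *)
Lemma derive1_slope_conv (R : realType) (I : set R) (Phi : R -> R)
    (t x y v : R) :
  convex_function (domT I) (Aphi Phi : (R^o * R^o)%type -> R^o) ->
  0 <= t <= 1 -> v != 0 -> domT I (x, v) -> domT I (y, v) ->
  let slope u := (Phi^`()%classic (u + v) - Phi^`()%classic u) / v in
  slope (t * x + (1 - t) * y) <= t * slope x + (1 - t) * slope y.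
Proof.
move=> A_convex t01 v0 Tx Ty; cbv zeta; set slope := fun u : R => _.
have slopeE u : slope u = (Aphi Phi (u, v) + Aphi Phi (tau (u, v))) / v ^+ 2.
  by rewrite /slope /Aphi /tau/= addrK; field.
have Ttau w : domT I w -> domT I (tau w).
  by move=> [Iu Iuv]; split; rewrite /tau/= ?addrK.
have Ale1 := Aphi_conv R I Phi t x v y v A_convex t01 Tx Ty.
have Ale2 := Aphi_conv R I Phi t _ _ _ _ A_convex t01 (Ttau _ Tx) (Ttau _ Ty).
rewrite !slopeE !mulrA -mulrDl ler_pM2r ?invr_gt0 ?exprn_even_gt0//.
apply: le_trans (_ : _ <= t * Aphi Phi (x, v) + (1 - t) * Aphi Phi (y, v) +
  (t * Aphi Phi (tau (x, v)) + (1 - t) * Aphi Phi (tau (y, v)))) _; last by lra.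
apply: lerD; first by move: Ale1; congr (Aphi Phi (_, _) <= _); ring.
by move: Ale2; congr (Aphi Phi _ <= _); congr pair; rewrite /=; ring.
Qed.

(** The difference quotients of [Phi'] with a fixed step [h] satisfy the convexity inequality, and
    it survives the limit [h -> 0]. Openness of [I] keeps [x + h] and [y + h] in [I] for small
    [h]. *)
Lemma derive2_convex (R : realType) (I : set R) (Phi : R -> R) :
  open I -> is_interval I -> smooth_on I Phi ->
  convex_function (domT I) (Aphi Phi : (R^o * R^o)%type -> R^o) ->
  convex_function (I : set R^o) (Phi^`(2)%classic : R^o -> R^o).
Proof.
move=> I_open I_itv Phi_smooth A_convex; apply/convex_functionP.
move=> t x y t01 Ix Iy.
have slope_cvg u : I u ->
    (Phi^`()%classic (u + h) - Phi^`()%classic u) / h @[h --> 0^'] -->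
      Phi^`(2)%classic u.
  by move=> Iu; exact/is_derive1_cvg/(is_derive_smooth_on R I Phi 1).
have Inear u : I u -> \forall h \near (0 : R)^', I (u + h).
  move=> Iu; apply: nbhs_dnbhs.
  have : (fun h : R => u + h) @ (0 : R) --> u + 0.
    by apply: cvgD; [exact: cvg_cst|exact: cvg_id].
  by rewrite addr0; apply; exact: open_nbhs_nbhs.
have Iz := is_interval_conv R I t x y I_itv t01 Ix Iy.
apply: (ler_cvg_to (slope_cvg _ Iz)).
  by apply: cvgD; apply: cvgMr; [exact: (slope_cvg x)|exact: (slope_cvg y)].
near=> h.
apply: (derive1_slope_conv R I) => //.
- by near: h; exact: nbhs_dnbhs_neq.
- by split => //=; near: h; exact: Inear.
- by split => //=; near: h; exact: Inear.
Unshelve. all: by end_near. Qed.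

(** * The two-point inequality *)

(** Common shape of the deficit [G] and of its derivative [G1], so that both are differentiated by
    the same rule. *)
Lemma is_derive1_combination (R : realType) (c0 c1 c2 c3 t : R)
    (F H K : R -> R) (dF dH dK : R) :
  is_derive t 1 F dF -> is_derive t 1 H dH -> is_derive t 1 K dK ->
  is_derive t 1 (fun s => c0 + s * c1 + c2 * F s + c3 * (s * H s) + K s)
    (c1 + c2 * dF + c3 * (H t + t * dH) + dK).
Proof.
move=> FdF HdH KdK.
have d1 := is_derive1_affine R c0 c1 t.
have d2 : is_derive t 1 (c2 *: F) (c2 *: dF) by exact: is_deriveZ.
have idd : is_derive t 1 (id : R -> R) 1 by exact: is_derive_id.
have d3 : is_derive t 1 ((id : R -> R) * H) (t *: dH + H t *: 1).
  exact: is_deriveM.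
have d4 : is_derive t 1 (c3 *: ((id : R -> R) * H)) (c3 *: (t *: dH + H t *: 1)).
  exact: is_deriveZ.
have d5 := is_deriveD (is_deriveD (is_deriveD d1 d2) d4) KdK.
apply: (is_derive_eq d5).
by rewrite /GRing.scale/= mulr1 [t * dH + _]addrC.
Qed.

(** As a function of [t], the deficit [G] of the inequality for the pair
    [(a, a + t (b - a))] satisfies [G 0 = G' 0 = 0], and, with
    [b_t = a + t (b - a)] and [m_t = p b_t + (1 - p) a], [G'' t] is
    [p^2 (b - a)^2 (Phi'' m_t - Phi'' b_t - Phi''' b_t (m_t - b_t))],
    which is nonnegative because [Phi''] is convex. *)
Lemma Ent_bernoulli_le (R : realType) (I : set R) (Phi : R -> R) (p a b : R) :
  open I -> is_interval I -> smooth_on I Phi ->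
  convex_function (domT I) (Aphi Phi : (R^o * R^o)%type -> R^o) ->
  0 <= p <= 1 -> I a -> I b ->
  p * Phi b + (1 - p) * Phi a - Phi (p * b + (1 - p) * a) <=
  p * (1 - p) * ((1 - p) * Aphi Phi (a, b - a) + p * Aphi Phi (b, a - b)).
Proof.
move=> I_open I_itv Phi_smooth A_convex p01 Ia Ib.
have Phi2_convex := derive2_convex R I Phi I_open I_itv Phi_smooth A_convex.
set d := b - a; set q := 1 - p.
have It s : s \in `[0, 1] -> I (a + s * d).
  rewrite in_itv/= => s01; have := is_interval_conv R I s b a I_itv s01 Ib Ia.
  by congr I; rewrite /d; ring.
(* The mean [m_t] is [a + (p t) d], so it lies in [I] by [It] at the parameter [p t]. *)
have pt01 (t : R) : t \in `[0, 1] -> p * t \in `[0, 1].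
  move: p01 => /andP[p0 p1]; rewrite !in_itv/= => /andP[t0 t1].
  by rewrite mulr_ge0//= mulr_ile1.
have dPhib m (t : R) : t \in `[0, 1] ->
    is_derive t 1 (fun s => Phi^`(m)%classic (a + s * d))
      (Phi^`(m.+1)%classic (a + t * d) * d).
  by move=> t01; apply/is_derive1_line/(is_derive_smooth_on R I)/It.
have dPhim m (t : R) : t \in `[0, 1] ->
    is_derive t 1 (fun s => Phi^`(m)%classic (a + s * (p * d)))
      (Phi^`(m.+1)%classic (a + t * (p * d)) * (p * d)).
  move=> t01; apply/is_derive1_line/(is_derive_smooth_on R I) => //.
  by rewrite mulrCA mulrA; exact/It/pt01.
have zero01 : (0 : R) \in `[0, 1] by rewrite in_itv/= lexx ler01.
have one01 : (1 : R) \in `[0, 1] by rewrite in_itv/= lexx ler01.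
(* Coefficients of the deficit, right-hand side minus left-hand side, for the pair [(a, a + t d)].
   That of [Phi b_t] is [p q^2 - p^2 q - p = - p^2 (1 + 2 q)]. *)
pose c1 : R := - (p * q ^+ 2 * d * Phi^`(1)%classic a).
pose c2 : R := - (p ^+ 2 * (1 + 2 * q)).
pose c3 : R := p ^+ 2 * q * d.
pose c0 : R := - (q * Phi a) + p * q * (p - q) * Phi a.
pose G t := c0 + t * c1 + c2 * Phi^`(0)%classic (a + t * d) +
  c3 * (t * Phi^`(1)%classic (a + t * d)) + Phi^`(0)%classic (a + t * (p * d)).
pose K t := p * d * Phi^`(1)%classic (a + t * (p * d)).
pose G1 t := c1 + t * 0 + (c2 * d + c3) * Phi^`(1)%classic (a + t * d) +
  (c3 * d) * (t * Phi^`(2)%classic (a + t * d)) + K t.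
have dG (t : R) : t \in `[0, 1] -> is_derive t 1 G (G1 t).
  move=> t01.
  apply: (is_derive_eq (is_derive1_combination R c0 c1 c2 c3 t _ _ _ _ _ _
    (dPhib 0%N t t01) (dPhib 1%N t t01) (dPhim 0%N t t01))).
  by rewrite /G1 /K; ring.
(* The coefficient of [Phi'' b_t] is [c2 d^2 + 2 c3 d], where the terms in [q] cancel to leave
   [- p^2 d^2]. The term in [Phi'''] comes from [m_t - b_t = - q t d]. *)
pose G2 t := p ^+ 2 * d ^+ 2 * (Phi^`(2)%classic (a + t * (p * d)) -
  Phi^`(2)%classic (a + t * d) -
  Phi^`(3)%classic (a + t * d) * (a + t * (p * d) - (a + t * d))).
have dG1 (t : R) : t \in `[0, 1] -> is_derive t 1 G1 (G2 t).
  move=> t01.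
  have dK : is_derive t 1 K (p * d * (Phi^`(2)%classic (a + t * (p * d)) * (p * d))).
    have := dPhim 1%N t t01 => dPhim1.
    by have := is_deriveZ (p * d) dPhim1.
  apply: (is_derive_eq (is_derive1_combination R c1 0 (c2 * d + c3) (c3 * d) t
    _ _ _ _ _ _ (dPhib 1%N t t01) (dPhib 2%N t t01) dK)).
  rewrite /G2 /c2 /c3 /q; move: (Phi^`(2)%classic (a + t * d)) => y.
  move: (Phi^`(2)%classic (a + t * (p * d))) (Phi^`(3)%classic (a + t * d)) => m z.
  by ring.
have G2_ge0 (t : R) : t \in `[0, 1] -> 0 <= G2 t.
  move=> t01; apply: mulr_ge0; first by rewrite mulr_ge0// sqr_ge0.
  have Ibt := It t t01.
  have Imt : I (a + t * (p * d)) by rewrite mulrCA mulrA; exact/It/pt01.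
  rewrite subr_ge0.
  exact: (convex_tangent R I _ _ _ _ Phi2_convex Ibt Imt
    (is_derive_smooth_on R I Phi 2 _ Phi_smooth Ibt)).
have G1_ge0 (t : R) : t \in `[0, 1] -> 0 <= G1 t.
  move=> t01; apply: le_trans (is_derive1_ge0_le R G1 G2 dG1 G2_ge0 t t01).
  rewrite /G1 /K !mul0r !addr0 /c1 /c2 /c3 /q.
  by rewrite le_eqVlt; apply/predU1P; left; ring.
(* [G 1] is the deficit for [(a, b)] and [G 0 = 0]. *)
have := is_derive1_ge0_le R G G1 dG G1_ge0 1 one01.
rewrite /G !mul0r !addr0 !mul1r !derive1n0 !derive1n1 mulr0 addr0.
have -> : a + d = b by rewrite /d; ring.
have -> : a + p * d = p * b + q * a by rewrite /q /d; ring.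
rewrite /Aphi/= !subrKC.
rewrite -subr_ge0 => G01; rewrite -subr_ge0; apply: le_trans G01 _.
rewrite /c0 /c1 /c2 /c3 /q /d derive1n1.
by rewrite le_eqVlt; apply/predU1P; left; ring.
Qed.

(** * Monotonicity of means and the chain rule for entropy *)

Lemma meanD (R : realType) (n : nat) (p : 'I_n -> {i01 R}) (f g : nat -> R) :
  mean (bernoulli_convolution p) (fun k => f k + g k) =
  mean (bernoulli_convolution p) f + mean (bernoulli_convolution p) g.
Proof. by apply: RintegralD => //; exact: integrable_bernoulli_convolution. Qed.

Lemma meanZ (R : realType) (n : nat) (p : 'I_n -> {i01 R}) (c : R)
    (f : nat -> R) :
  mean (bernoulli_convolution p) (fun k => c * f k) =
  c * mean (bernoulli_convolution p) f.
Proof. by apply: RintegralZl => //; exact: integrable_bernoulli_convolution. Qed.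

(** A sum of [n] Bernoulli variables is at most [n]. The restriction to [k <= n] matters because the
    weight [n - k] is negative beyond. *)
Lemma le_mean (R : realType) (n : nat) (p : 'I_n -> {i01 R})
    (f g : nat -> R) :
  (forall k, (k <= n)%N -> f k <= g k) ->
  mean (bernoulli_convolution p) f <= mean (bernoulli_convolution p) g.
Proof.
elim: n p f g => [|n IHn] p f g fg.
  by rewrite !mean_bernoulli_convolution0 fg.
rewrite !mean_bernoulli_convolutionS; apply: IHn => k kn.
by apply: lerD; apply: ler_wpM2l; rewrite ?subr_ge0 ?ge0 ?le1 ?fg// leqW.
Qed.

(** Conditional mean of [f] given that the other variables sum to [k]; this is the function [g] of
    the overview. *)
Definition bern_conv (R : realType) (p : R) (f : nat -> R) (k : nat) : R :=
  p * f k.+1 + (1 - p) * f k.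

Lemma Ent_bernoulli_convolutionS (R : realType) (Phi : R -> R) (n : nat)
    (p : 'I_n.+1 -> {i01 R}) (f : nat -> R) :
  let p0 := (p ord0)%:num in
  Ent Phi (bernoulli_convolution p) f =
  mean (bernoulli_convolution (p \o lift ord0))
    (fun k => bern_conv R p0 (Phi \o f) k - Phi (bern_conv R p0 f k)) +
  Ent Phi (bernoulli_convolution (p \o lift ord0)) (bern_conv R p0 f).
Proof.
move=> p0; rewrite /Ent !mean_bernoulli_convolutionS addrA -meanD.
by congr (mean _ _ - _); apply/funext => k; rewrite subrK.
Qed.

(** * Induction on the number of Bernoulli factors *)

Section binomial_entropy.
Variables (R : realType) (I : set R) (Phi : R -> R).
Hypotheses (I_open : open I) (I_itv : is_interval I).
Hypothesis Phi_smooth : smooth_on I Phi.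
Hypothesis Phi_convex : convex_function (I : set R^o) (Phi : R^o -> R^o).
Hypothesis A_convex :
  convex_function (domT I) (Aphi Phi : (R^o * R^o)%type -> R^o).

Let i01_bounds (t : {i01 R}) : 0 <= t%:num <= 1.
Proof. by rewrite ge0 le1. Qed.

Let bern_conv_in (t : {i01 R}) (f : nat -> R) :
  (forall k, I (f k)) -> forall k, I (bern_conv R t%:num f k).
Proof. by move=> If k; exact: is_interval_conv. Qed.

Let domT_sub (a b : R) : I a -> I b -> domT I (a, b - a).
Proof. by move=> Ia Ib; split; rewrite //= subrKC. Qed.

(** The pair on the left is the convex combination of the pairs built on the shift of [f] and on
    [f]. Free indices [j] and [k] let it serve forward and backward gradients alike. *)
Let Aphi_bern_conv (t : {i01 R}) (f : nat -> R) (j k : nat) :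
  (forall k, I (f k)) ->
  Aphi Phi (bern_conv R t%:num f j,
            bern_conv R t%:num f k - bern_conv R t%:num f j) <=
  t%:num * Aphi Phi (f j.+1, f k.+1 - f j.+1) +
     (1 - t%:num) * Aphi Phi (f j, f k - f j).
Proof.
move=> If.
have := Aphi_conv R I Phi t%:num _ _ _ _ A_convex (i01_bounds t)
  (domT_sub _ _ (If j.+1) (If k.+1)) (domT_sub _ _ (If j) (If k)).
by congr (Aphi Phi (_, _) <= _); rewrite /bern_conv; ring.
Qed.

Let Ent_bernoulli_conv (t : {i01 R}) (f : nat -> R) (k : nat) :
  (forall k, I (f k)) ->
  bern_conv R t%:num (Phi \o f) k - Phi (bern_conv R t%:num f k) <=
  t%:num * (1 - t%:num) * ((1 - t%:num) * Aphi Phi (f k, f k.+1 - f k) +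
    t%:num * Aphi Phi (f k.+1, f k - f k.+1)).
Proof.
by move=> If; exact: (Ent_bernoulli_le R I).
Qed.

(** An arbitrary common bound [C] replaces the maximum, so that the same constant passes to the
    remaining parameters in the induction. *)
Lemma Ent_bernoulli_convolution_le (n : nat) (p : 'I_n -> {i01 R}) (C : R)
    (f : nat -> R) :
  (forall i, (p i)%:num * (1 - (p i)%:num) <= C) -> (forall k, I (f k)) ->
  Ent Phi (bernoulli_convolution p) f <=
  C * mean (bernoulli_convolution p)
        (fun k => (n%:R - k%:R) * Aphi Phi (f k, Dgrad f k)
                  + k%:R * Aphi Phi (f k, Dgrad_star f k)).
Proof.
elim: n p f => [|n IHn] p f pC If.
  by rewrite /Ent !mean_bernoulli_convolution0 !subrr !mul0r addr0 mulr0.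
set g := bern_conv R (p ord0)%:num f.
have Ig : forall k, I (g k) by exact: bern_conv_in.
rewrite Ent_bernoulli_convolutionS.
apply: le_trans (lerD (lexx _) (IHn _ g (fun i => pC (lift ord0 i)) Ig)) _.
(* All terms are now means under the law of the last [n] variables and can be compared pointwise for
   [k <= n]. *)
rewrite mean_bernoulli_convolutionS -!meanZ -meanD; apply: le_mean => k kn.
have p01 := i01_bounds (p ord0); move/andP: (p01) => [p0 p1].
have Ak := Aphi_ge0 R I Phi _ Phi_smooth Phi_convex (domT_sub _ _ (If k) (If k.+1)).
have Ak' := Aphi_ge0 R I Phi _ Phi_smooth Phi_convex (domT_sub _ _ (If k.+1) (If k)).
have pq_ge0 : 0 <= (p ord0)%:num * (1 - (p ord0)%:num).
  by rewrite mulr_ge0// subr_ge0.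
have C_ge0 : 0 <= C by exact: le_trans pq_ge0 (pC ord0).
have two_points : bern_conv R (p ord0)%:num (Phi \o f) k - Phi (g k) <=
    C * ((1 - (p ord0)%:num) * Aphi Phi (f k, f k.+1 - f k) +
         (p ord0)%:num * Aphi Phi (f k.+1, f k - f k.+1)).
  apply: le_trans (Ent_bernoulli_conv (p ord0) f k If) _.
  by rewrite ler_wpM2r// addr_ge0// mulr_ge0// subr_ge0.
have up : (n%:R - k%:R) * Aphi Phi (g k, Dgrad g k) <= (n%:R - k%:R) *
    ((p ord0)%:num * Aphi Phi (f k.+1, f k.+2 - f k.+1) +
     (1 - (p ord0)%:num) * Aphi Phi (f k, f k.+1 - f k)).
  by rewrite ler_wpM2l ?subr_ge0 ?ler_nat//; exact: Aphi_bern_conv.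
have down : k%:R * Aphi Phi (g k, Dgrad_star g k) <= k%:R *
    ((p ord0)%:num * Aphi Phi (f k.+1, f k - f k.+1) +
     (1 - (p ord0)%:num) * Aphi Phi (f k, f k.-1 - f k)).
  (* At [k = 0] the factor [k] vanishes. At a successor [k.-1.+1 = k], which turns the shifted
     backward gradient into [f k - f k.+1]. *)
  case: k {kn Ak Ak' two_points up} => [|k]; first by rewrite !mul0r.
  by rewrite ler_wpM2l//; exact: Aphi_bern_conv.
apply: le_trans (lerD two_points (ler_wpM2l C_ge0 (lerD up down))) _.
(* The two-point bound supplies the missing units: it raises [n - k] to [n + 1 - k] at [k], and [k]
   to [k + 1] at [k + 1]. *)
rewrite -mulrDr ler_wpM2l// /Dgrad /Dgrad_star/=.
by rewrite le_eqVlt; apply/predU1P; left; rewrite -![_.+1%:R]natr1; ring.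
Qed.

(** A second induction: convexity bounds [n] times the mean over [n - 1] variables for [g] by [n]
    times the mean over [n] variables for [f], and the two-point term adds one more such mean. *)
Lemma Ent_binomial_le (n : nat) (p : {i01 R}) (f : nat -> R) :
  (forall k, I (f k)) ->
  Ent Phi (binomial_law n p) f <=
  n%:R * p%:num * (1 - p%:num) * mean (binomial_law n.-1 p)
    (fun k => (1 - p%:num) * Aphi Phi (f k, Dgrad f k)
              + p%:num * Aphi Phi (tau (f k, Dgrad f k))).
Proof.
have tauE h k : tau (h k, Dgrad h k) = (h k.+1, h k - h k.+1) :> R * R.
  by rewrite /tau/= subrKC opprB.
rewrite /binomial_law; elim: n f => [|n IHn] f If.
  by rewrite /Ent !mean_bernoulli_convolution0 subrr !mul0r.
pose w h k := (1 - p%:num) * Aphi Phi (h k, Dgrad h k)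
              + p%:num * Aphi Phi (tau (h k, Dgrad h k)).
set g := bern_conv R p%:num f.
have /andP[p0 p1] := i01_bounds p.
have q0 : 0 <= 1 - p%:num by rewrite subr_ge0.
have Ig : forall k, I (g k) by exact: bern_conv_in.
have w_le : n%:R * mean (bernoulli_convolution (fun _ : 'I_n.-1 => p)) (w g) <=
    n%:R * mean (bernoulli_convolution (fun _ : 'I_n => p)) (w f).
  (* At [n = 0] the factor [n] makes the truncated [0.-1] harmless. Otherwise the extra variable on
     the right is conditioned out. *)
  case: n {IHn} => [|n]; first by rewrite !mul0r.
  rewrite ler_wpM2l// mean_bernoulli_convolutionS; apply: le_mean => k _.
  rewrite /w !tauE /Dgrad.
  have up := Aphi_bern_conv p f k k.+1 If.
  have down := Aphi_bern_conv p f k.+1 k If.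
  apply: le_trans (lerD (ler_wpM2l q0 up) (ler_wpM2l p0 down)) _.
  by rewrite le_eqVlt; apply/predU1P; left; ring.
rewrite Ent_bernoulli_convolutionS.
apply: le_trans (lerD (lexx _) (IHn g Ig)) _.
have pq0 : 0 <= p%:num * (1 - p%:num) by rewrite mulr_ge0.
have two_points : mean (bernoulli_convolution (fun _ : 'I_n => p))
    (fun k => bern_conv R p%:num (Phi \o f) k - Phi (g k)) <=
    p%:num * (1 - p%:num) * mean (bernoulli_convolution (fun _ : 'I_n => p)) (w f).
  rewrite -meanZ; apply: le_mean => k _.
  by apply: le_trans (Ent_bernoulli_conv p f k If) _; rewrite /w tauE.
have swap m x : m * p%:num * (1 - p%:num) * x = p%:num * (1 - p%:num) * (m * x) :> R.
  by ring.
rewrite swap; apply: le_trans (lerD two_points (ler_wpM2l pq0 w_le)) _.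
by rewrite swap -mulrDr -nat1r mulrDl mul1r.
Qed.

End binomial_entropy.

Theorem theorem2p3 (R : realType) (I : set R) (Phi : R -> R)
  (I_open : open I) (I_itv : is_interval I)
  (Phi_smooth : smooth_on I Phi)
  (Phi_convex : convex_function (I : set R^o) (Phi : R^o -> R^o))
  (A_convex : convex_function (domT I) (Aphi Phi : (R^o * R^o)%type -> R^o)) :
  (forall (n : nat) (p : 'I_n -> {i01 R}) (f : nat -> R),
      (0 < n)%N -> (forall k, I (f k)) ->
      let h := fun k : nat => k%:R : R in
      let M := bernoulli_convolution p in
      let C_M := max_pq p in
      Ent Phi M f <=
      C_M * mean M (fun k => (n%:R - h k) * Aphi Phi (f k, Dgrad f k)
                             + h k * Aphi Phi (f k, Dgrad_star f k)))
  /\ (forall (n : nat) (p : {i01 R}) (f : nat -> R),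
      (0 < n)%N -> (forall k, I (f k)) ->
      let h := fun k : nat => k%:R : R in
      let q := 1 - p%:num in
      Ent Phi (binomial_law n p) f <=
      p%:num * q * mean (binomial_law n p)
                     (fun k => (n%:R - h k) * Aphi Phi (f k, Dgrad f k)
                               + h k * Aphi Phi (f k, Dgrad_star f k)))
  /\ (forall (n : nat) (p : {i01 R}) (f : nat -> R),
      (0 < n)%N -> (forall k, I (f k)) ->
      let q := 1 - p%:num in
      Ent Phi (binomial_law n p) f <=
      n%:R * p%:num * q * mean (binomial_law n.-1 p)
                     (fun k => q * Aphi Phi (f k, Dgrad f k)
                               + p%:num * Aphi Phi (tau (f k, Dgrad f k)))).
Proof.
split; [|split] => [n p f _ If /=|n p f _ If /=|n p f _ If /=].
- apply: (Ent_bernoulli_convolution_le R I) => // i.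
  exact: (le_bigmax_cond _ (fun i => (p i)%:num * (1 - (p i)%:num))).
(* With equal parameters, [C] is [p q] itself. *)
- exact: (Ent_bernoulli_convolution_le R I).
- exact: (Ent_binomial_le R I).
Qed.
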